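(* Let $(\lambda_k)_{k\ge1}$ and $(\mu_k)_{k\ge1}$ be real sequences with $\sum_{k=1}^\infty(|\lambda_k|+|\mu_k|)\le 1/2$, and let $C$ be the copula $$C(u,v)=uv+\frac{1}{2\pi^2}\sum_{k=1}^\infty\frac{\lambda_k}{k^2}\sin(2\pi ku)\sin(2\pi kv)+\frac{1}{2\pi^2}\sum_{k=1}^\infty\frac{\mu_k}{k^2}(1-\cos 2\pi ku)(1-\cos 2\pi kv).$$ Then the Spearman's $\rho_S(C)$ and the Kendall's $\tau(C)$ are $$\rho_S(C)=\frac{6}{\pi^2}\sum_{k=1}^\infty\frac{\mu_k}{k^2},\qquad -\frac{3}{\pi^2}\le\rho_S(C)\le\frac{3}{\pi^2},$$ $$\tau(C)=\frac{1}{\pi^2}\sum_{k=1}^\infty\frac{4\mu_k+2\lambda_k\mu_k}{k^2},\qquad -\frac{2}{\pi^2}\le\tau(C)\le\frac{2}{\pi^2}.$$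
   Context: For a copula $C$ on $[0,1]^2$, Spearman's rho and Kendall's tau are defined by $$\rho_S(C)=12\int_0^1\int_0^1 C(u,v)\,du\,dv-3,\qquad \tau(C)=1-4\int_0^1\int_0^1 C_{,1}(u,v)C_{,2}(u,v)\,du\,dv,$$ where $C_{,i}$ is the partial derivative of $C$ with respect to its $i$-th variable. *)

(* Defs.v *)
From mathcomp Require Import all_boot all_order all_algebra.
From mathcomp Require Import all_classical all_reals all_analysis.
From mathcomp Require Import ring lra.
Set Implicit Arguments. Unset Strict Implicit. Unset Printing Implicit Defensive.
Import Order.TTheory GRing.Theory Num.Theory.
Import numFieldNormedType.Exports.
Local Open Scope classical_set_scope.
Local Open Scope ring_scope.

(* Real-valued counterpart of the library's extended-real series notation. *)
Notation "\sum_ ( m <= i <oo ) F" :=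
  (\big[+%R/0%R]_(m <= i <oo) F%R) : ring_scope.

(* Copulas are represented by functions on R x R of which only the values on
   the unit square are constrained. *)
Definition is_copula (R : realType) (C : R -> R -> R) : Prop :=
  [/\ (forall u : R, u \in `[0, 1] -> C u 0 = 0 /\ C u 1 = u),
      (forall v : R, v \in `[0, 1] -> C 0 v = 0 /\ C 1 v = v) &
      (forall u1 u2 v1 v2 : R,
         0 <= u1 -> u1 <= u2 -> u2 <= 1 -> 0 <= v1 -> v1 <= v2 -> v2 <= 1 ->
         0 <= C u2 v2 - C u1 v2 - C u2 v1 + C u1 v1)].

Definition partial1 (R : realType) (C : R -> R -> R) (u v : R) : R :=
  derive1 (fun x : R => C x v) u.

Definition partial2 (R : realType) (C : R -> R -> R) (u v : R) : R :=
  derive1 (fun y : R => C u y) v.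

Definition spearman_rho (R : realType) (C : R -> R -> R) : R :=
  12 * (\int[lebesgue_measure]_(v in `[0%R, 1%R])
          (\int[lebesgue_measure]_(u in `[0%R, 1%R]) C u v)) - 3.

(* The partial derivatives of a copula exist almost everywhere; where one does
   not exist (possibly on the boundary of the square, where the function is not
   constrained outside), the library's default value does not affect the
   Lebesgue integral. *)
Definition kendall_tau (R : realType) (C : R -> R -> R) : R :=
  1 - 4 * (\int[lebesgue_measure]_(v in `[0%R, 1%R])
             (\int[lebesgue_measure]_(u in `[0%R, 1%R])
                (partial1 C u v * partial2 C u v))).

Definition trig_copula (R : realType) (lambda mu : nat -> R) (u v : R) : R :=
  u * v
  + 1 / (2 * pi ^+ 2) * (\sum_(1 <= k <oo)
      (lambda k / k%:R ^+ 2
       * sin (2 * pi * k%:R * u) * sin (2 * pi * k%:R * v)))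
  + 1 / (2 * pi ^+ 2) * (\sum_(1 <= k <oo)
      (mu k / k%:R ^+ 2
       * (1 - cos (2 * pi * k%:R * u)) * (1 - cos (2 * pi * k%:R * v)))).

Section TrigCopula.
Variables (R : realType) (lambda mu : nat -> R).
Hypothesis Hsum :
  (\sum_(1 <= k <oo) (`|lambda k| + `|mu k|)%:E <= (1 / 2)%:E)%E.
Implicit Types (u v x y : R) (n k : nat).

Let a k : R := `|lambda k| + `|mu k|.

Let a_ge0 k : 0 <= a k. Proof. by rewrite addr_ge0. Qed.

Let partial_sum_le n : \sum_(1 <= k < n) a k <= 1 / 2.
Proof.
rewrite -lee_fin -sumEFin; apply: le_trans Hsum.
by apply: nneseries_lim_ge => k _ _; rewrite lee_fin a_ge0.
Qed.

Let cvg_dominated (w : nat -> R) (M : R) : 0 <= M ->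
  (forall k, `|w k| <= M * a k) -> cvgn (fun n => \sum_(1 <= k < n) w k).
Proof.
move=> M0 wa.
pose z k : R := if k is 0%N then 0 else w k.
have zE (f : nat -> R) n :
    \sum_(0 <= k < n) (if k is 0%N then 0 else f k) = \sum_(1 <= k < n) f k.
  case: n => [|n]; first by rewrite !big_geq.
  rewrite big_nat_recl// add0r [RHS]big_add1 /=.
  by apply: eq_bigr => k _.
have -> : (fun n => \sum_(1 <= k < n) w k) = series z.
  by apply/funext => n; rewrite /series /= -zE.
apply: normed_cvg; apply: nondecreasing_is_cvgn.
  by apply: nondecreasing_series => k _ _; exact: normr_ge0.
exists (M * (1 / 2)) => _ [n _ <-] /=.
apply: le_trans (_ : M * \sum_(1 <= k < n) a k <= _); last first.
  by rewrite ler_wpM2l// partial_sum_le.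
rewrite mulr_sumr -zE /series /=; apply: ler_sum => -[|k] _; first by rewrite normr0.
exact: wa.
Qed.

Let lip (f df : R -> R) : (forall x, is_derive x 1 f (df x)) ->
  (forall x, `|df x| <= 1) -> forall x y, `|f y - f x| <= `|y - x|.
Proof.
move=> fd df1 x y; wlog xy : x y / x <= y => [H|].
  by case: (leP x y) => [/H//|/ltW /H]; rewrite distrC (distrC y).
have [|c _ ->] := @MVT_segment R f df x y xy (fun z _ => fd z).
- apply: continuous_subspaceT => z; apply/differentiable_continuous.
  by apply/derivable1_diffP; have [] := fd z.
- by rewrite normrM ler_piMl.
Qed.

Let sin_lip x y : `|sin y - sin x| <= `|y - x|.
Proof. by apply: (lip (@is_derive_sin R)) => z; exact: cos_max. Qed.

Let cos_lip x y : `|cos y - cos x| <= `|y - x|.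
Proof.
by apply: (lip (@is_derive_cos R)) => z; rewrite normrN; exact: sin_max.
Qed.

Let S u k : R := sin (2 * pi * k%:R * u).
Let D u k : R := 1 - cos (2 * pi * k%:R * u).
Let P u v n : R := \sum_(1 <= k < n) (lambda k / k%:R ^+ 2 * S u k * S v k).
Let Q u v n : R := \sum_(1 <= k < n) (mu k / k%:R ^+ 2 * D u k * D v k).
Let T u v n : R := u * v + 1 / (2 * pi ^+ 2) * P u v n + 1 / (2 * pi ^+ 2) * Q u v n.

Let invk_le1 k : `|(k%:R ^+ 2 : R)^-1| <= 1.
Proof.
case: k => [|k]; first by rewrite expr0n /= invr0 normr0.
by rewrite ger0_norm ?invr_ge0 ?exprn_ge0// invf_le1 ?exprn_gt0// exprn_ege1// ler1n.
Qed.

Let D_le2 u k : `|D u k| <= 2.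
Proof.
apply: le_trans (ler_normB _ _) _; rewrite normr1.
by rewrite (_ : 2 = 1 + 1 :> R)// lerD2l cos_max.
Qed.

Let cvgP u v : cvgn (P u v).
Proof.
apply: (@cvg_dominated _ 1) => // k; rewrite mul1r 3!normrM.
apply: le_trans (_ : `|lambda k| <= _); last by rewrite lerDl.
rewrite -[leRHS]mulr1 -[leRHS]mulr1 -[leRHS]mulr1.
by rewrite !ler_pM// ?mulr_ge0// ?sin_max// ?invk_le1.
Qed.

Let cvgQ u v : cvgn (Q u v).
Proof.
apply: (@cvg_dominated _ 4) => // k; rewrite 3!normrM.
apply: le_trans (_ : 4 * `|mu k| <= _); last by rewrite ler_pM2l// lerDr.
rewrite (_ : 4 * `|mu k| = `|mu k| * 1 * 2 * 2); last first.
  by rewrite mulr1 -mulrA -natrM mulrC.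
by rewrite !ler_pM// ?mulr_ge0// ?D_le2// ?invk_le1.
Qed.

Let cvgT u v : T u v n @[n --> \oo] --> trig_copula lambda mu u v.
Proof.
rewrite /trig_copula; apply: cvgD; last by apply: cvgMr; exact: cvgQ.
by apply: cvgD; [exact: cvg_cst|apply: cvgMr; exact: cvgP].
Qed.

Let T_rect u1 u2 v1 v2 n : u1 <= u2 -> v1 <= v2 ->
  0 <= T u2 v2 n - T u1 v2 n - T u2 v1 n + T u1 v1 n.
Proof.
move=> u12 v12.
have pi20 : 0 < (2 * pi ^+ 2 : R) by rewrite mulr_gt0// exprn_gt0// pi_gt0.
set A := (u2 - u1) * (v2 - v1).
have A0 : 0 <= A by rewrite mulr_ge0// subr_ge0.
pose w k := lambda k / k%:R ^+ 2 * (S u2 k - S u1 k) * (S v2 k - S v1 k)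
  + mu k / k%:R ^+ 2 * (D u2 k - D u1 k) * (D v2 k - D v1 k).
have -> : T u2 v2 n - T u1 v2 n - T u2 v1 n + T u1 v1 n
    = A + 1 / (2 * pi ^+ 2) * \sum_(1 <= k < n) w k.
  have -> : \sum_(1 <= k < n) w k = (P u2 v2 n - P u1 v2 n - P u2 v1 n + P u1 v1 n)
      + (Q u2 v2 n - Q u1 v2 n - Q u2 v1 n + Q u1 v1 n).
    rewrite /P /Q -!sumrB -!big_split /=; apply: eq_bigr => k _.
    by rewrite /w; ring.
  by rewrite /T /A; ring.
have wle : `|\sum_(1 <= k < n) w k| <= (2 * pi ^+ 2) * A.
  apply: le_trans (ler_norm_sum _ _ _) _.
  apply: le_trans (_ : \sum_(1 <= k < n) (4 * pi ^+ 2 * A) * a k <= _); last first.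
    rewrite -mulr_sumr (_ : 2 * pi ^+ 2 * A = 4 * pi ^+ 2 * A * (1 / 2)); last by field.
    by rewrite ler_wpM2l// mulr_ge0// mulr_ge0// exprn_ge0// pi_ge0.
  rewrite big_nat_cond [leRHS]big_nat_cond.
  apply: ler_sum => k /andP[/andP[k1 _] _].
  have k0 : 0 < (k%:R : R) by rewrite ltr0n.
  have tk0 : 0 <= 2 * pi * k%:R :> R by rewrite !mulr_ge0// pi_ge0.
  have Sl x y : x <= y -> `|S y k - S x k| <= 2 * pi * k%:R * (y - x).
    move=> xy; apply: le_trans (sin_lip _ _) _.
    by rewrite -mulrBr ger0_norm// mulr_ge0// subr_ge0.
  have Dl x y : x <= y -> `|D y k - D x k| <= 2 * pi * k%:R * (y - x).
    move=> xy; rewrite (_ : D y k - D x k =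
      cos (2 * pi * k%:R * x) - cos (2 * pi * k%:R * y)); last by rewrite /D; ring.
    rewrite distrC; apply: le_trans (cos_lip _ _) _.
    by rewrite -mulrBr ger0_norm// mulr_ge0// subr_ge0.
  have E (c : R) : `|c| * (k%:R ^+ 2)^-1 * (2 * pi * k%:R * (u2 - u1))
      * (2 * pi * k%:R * (v2 - v1)) = 4 * pi ^+ 2 * A * `|c|.
    by rewrite /A; field; rewrite gt_eqF.
  rewrite /a mulrDr -!E; apply: le_trans (ler_normD _ _) _.
  have kV : `|(k%:R ^+ 2 : R)^-1| = (k%:R ^+ 2)^-1.
    by rewrite ger0_norm// invr_ge0 exprn_ge0.
  by apply: lerD; rewrite 3!normrM kV !ler_pM// ?mulr_ge0// ?invr_ge0 ?exprn_ge0//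
    ?Sl ?Dl.
have : `|1 / (2 * pi ^+ 2) * \sum_(1 <= k < n) w k| <= A.
  rewrite normrM mul1r (@ger0_norm _ (_^-1)); last by rewrite invr_ge0 ltW.
  by rewrite ler_pdivrMl.
by rewrite ler_norml => /andP[+ _]; rewrite -subr_ge0 opprK addrC.
Qed.

Let two_pi_nat k : sin (2 * pi * k%:R : R) = 0 /\ cos (2 * pi * k%:R : R) = 1.
Proof.
have -> : 2 * pi * k%:R = 0 + pi *+ 2 *+ k :> R.
  by rewrite add0r -(mulr_natr _ k) -(mulr_natr pi 2); ring.
elim: k => [|k [IHs IHc]]; first by rewrite mulr0n addr0 sin0 cos0.
by rewrite mulrSr addrA sinD2pi cosD2pi.
Qed.

Let edge u v : (forall n, T u v n = u * v) ->
  trig_copula lambda mu u v = u * v.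
Proof.
move=> h; rewrite -(cvg_lim (@Rhausdorff R) (@cvgT u v)).
by rewrite (_ : (fun n => T u v n) = fun=> u * v) ?lim_cst//; exact/funext.
Qed.

Lemma trig_copulaP : is_copula (trig_copula lambda mu).
Proof.
have S0 k : S 0 k = 0 by rewrite /S mulr0 sin0.
have D0 k : D 0 k = 0 by rewrite /D mulr0 cos0 subrr.
have S1 k : S 1 k = 0 by rewrite /S mulr1 (two_pi_nat k).1.
have D1 k : D 1 k = 0 by rewrite /D mulr1 (two_pi_nat k).2 subrr.
have edger b u : (forall k, S b k = 0) -> (forall k, D b k = 0) ->
    trig_copula lambda mu u b = u * b /\ trig_copula lambda mu b u = b * u.
  move=> Sb Db; split; apply: edge => // n; rewrite /T /P /Q.
    by rewrite !big1 ?mulr0 ?addr0// => k _; rewrite ?Sb ?Db mulr0.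
  by rewrite !big1 ?mulr0 ?addr0// => k _; rewrite ?Sb ?Db mulr0 mul0r.
split.
- move=> u _; have [-> _] := edger _ u S0 D0; have [-> _] := edger _ u S1 D1.
  by rewrite mulr0 mulr1.
- move=> v _; have [_ ->] := edger _ v S0 D0; have [_ ->] := edger _ v S1 D1.
  by rewrite mul0r mul1r.
- move=> u1 u2 v1 v2 _ u12 _ _ v12 _.
  have c : (T u2 v2 n - T u1 v2 n - T u2 v1 n + T u1 v1 n) @[n --> \oo] -->
      trig_copula lambda mu u2 v2 - trig_copula lambda mu u1 v2
      - trig_copula lambda mu u2 v1 + trig_copula lambda mu u1 v1.
    by apply: cvgD; [apply: cvgB; [apply: cvgB|]|]; exact: cvgT.
  rewrite -(cvg_lim (@Rhausdorff R) c); apply: limr_ge; first by apply/cvg_ex; eexists; exact: c.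
  by near=> n; exact: T_rect.
Unshelve. all: by end_near.
Qed.

End TrigCopula.

(* Main.v *)
Require Import Defs.
From mathcomp Require Import all_boot all_order all_algebra.
From mathcomp Require Import all_classical all_reals all_analysis.
From mathcomp Require Import measurable_realfun ring lra.
Set Implicit Arguments. Unset Strict Implicit. Unset Printing Implicit Defensive.
Import Order.TTheory GRing.Theory Num.Theory.
Import numFieldNormedType.Exports.
Local Open Scope classical_set_scope.
Local Open Scope ring_scope.

(** Differentiating the series in [u] costs one factor [2 pi k], which the
    weight [1 / k^2] absorbs, so the partial sums of [C], of its partial
    derivatives, and of the product of the latter converge uniformly on the unit
    square, with an error controlled by the tail of [sum_k |lambda k| + |mu k|].
    Both double integrals are therefore limits of integrals of trigonometric
    polynomials, which orthogonality reduces to single sums: only [1 - cos] has a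
    nonzero mean, and in the Kendall integrand only the linear terms and the
    diagonal products [lambda k * mu k] survive.  The bound on [tau] also uses
    [|mu k| <= 1/2]. *)

(** * Integration over the unit interval *)

(* The open interval is used because [partial1] and [partial2] may take junk
   values on the boundary of the square. *)
Definition has_int01 (R : realType) (f : R -> R) (c : R) : Prop :=
  (@lebesgue_measure R).-integrable `]0%R, 1%R[ (EFin \o f) /\
  \int[lebesgue_measure]_(x in `]0%R, 1%R[) f x = c.

Section HasInt01.
Variable R : realType.
Implicit Types (f g F : R -> R) (b c : R).
Notation mu := (@lebesgue_measure R).

(** The two endpoints form a null set, so the closed interval of [spearman_rho] and [kendall_tau]
    may be exchanged for the open one. *)
Lemma has_int01_Rintegral f c :
  has_int01 f c -> \int[lebesgue_measure]_(x in `[0%R, 1%R]) f x = c.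
Proof.
case=> fi <-; rewrite /Rintegral integral_itv_bndoo//.
exact: measurable_int fi.
Qed.

Lemma eq_has_int01 f g c :
  (forall x, 0 < x < 1 -> f x = g x) -> has_int01 f c -> has_int01 g c.
Proof.
move=> fg [fi <-]; split.
  apply: eq_integrable fi => // x; rewrite inE/= in_itv/= => x01.
  by rewrite fg.
by apply: eq_Rintegral => x; rewrite inE/= in_itv/= => x01; rewrite fg.
Qed.

(** The source of the basic integrals below: an antiderivative on the whole line, with integrability
    coming from compactness of the closed segment. *)
Lemma has_int01_FTC F f : (forall x : R, is_derive x 1 F (f x)) ->
  continuous f -> has_int01 f (F 1 - F 0).
Proof.
move=> dF cf.
have cF : continuous F.
  move=> z; apply/differentiable_continuous/derivable1_diffP.
  by have [] := dF z.
have fi : mu.-integrable `[0%R, 1%R] (EFin \o f).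
  apply: continuous_compact_integrable; first exact: segment_compact.
  exact: continuous_subspaceT.
have fi' : mu.-integrable `]0%R, 1%R[ (EFin \o f).
  by apply: integrableS fi => //; exact: subset_itv_oo_cc.
split=> //; rewrite /Rintegral -(integral_itv_bndoo true false); last first.
  exact: measurable_int fi'.
rewrite (@continuous_FTC2 _ _ F)//.
- exact: continuous_subspaceT.
- split; first by move=> x _; have [] := dF x.
    by apply: cvg_at_right_filter; exact: cF.
  by apply: cvg_at_left_filter; exact: cF.
- by move=> x _; rewrite derive1E; have [_ ->] := dF x.
Qed.

Lemma has_int01D f g b c :
  has_int01 f b -> has_int01 g c -> has_int01 (fun x => f x + g x) (b + c).
Proof.
move=> [fi <-] [gi <-]; split; last by rewrite RintegralD.
exact: (integrableD _ fi gi).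
Qed.

Lemma has_int01Z k f c : has_int01 f c -> has_int01 (fun x => k * f x) (k * c).
Proof.
move=> [fi <-]; split; last by rewrite RintegralZl.
exact: (integrableZl _ k fi).
Qed.

Lemma has_int01N f c : has_int01 f c -> has_int01 (fun x => - f x) (- c).
Proof.
move=> /(@has_int01Z (-1)); rewrite mulN1r; apply: eq_has_int01 => x _.
by rewrite mulN1r.
Qed.

Lemma has_int01B f g b c :
  has_int01 f b -> has_int01 g c -> has_int01 (fun x => f x - g x) (b - c).
Proof. by move=> fb /has_int01N; exact: has_int01D. Qed.

Lemma has_int01_cst c : has_int01 (fun=> c) c.
Proof.
have := @has_int01_FTC (fun x => c * x) (fun=> c).
rewrite mulr1 mulr0 subr0; apply; last by move=> x; exact: cvg_cst.
by move=> x; apply: is_derive_eq; rewrite [LHS]mulr1.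
Qed.

(** The premise is restricted to [i \in s] so that index ranges supply [0 < k], hence nonzero
    frequencies. *)
Lemma has_int01_sum (I : eqType) (s : seq I) (F : I -> R -> R) (v : I -> R) :
  (forall i, i \in s -> has_int01 (F i) (v i)) ->
  has_int01 (fun x => \sum_(i <- s) F i x) (\sum_(i <- s) v i).
Proof.
elim: s => [_|i s ih H].
  by rewrite big_nil; apply: eq_has_int01 (has_int01_cst 0) => x _; rewrite big_nil.
rewrite big_cons.
have H1 := H i (mem_head _ _).
have H2 : has_int01 (fun x => \sum_(j <- s) F j x) (\sum_(j <- s) v j).
  by apply: ih => j js; apply: H; rewrite in_cons js orbT.
by apply: eq_has_int01 (has_int01D H1 H2) => x _; rewrite big_cons.
Qed.

Lemma le_has_int01 f g b c :
  (forall x, 0 < x < 1 -> f x <= g x) -> has_int01 f b -> has_int01 g c -> b <= c.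
Proof.
by move=> fg [fi <-] [gi <-]; apply: le_Rintegral => // x; rewrite /= in_itv; exact: fg.
Qed.

(** The interval has length 1, so a pointwise error passes to the integral with the same
    constant. *)
Lemma dist_has_int01 f g b c e :
  (forall x, 0 < x < 1 -> `|f x - g x| <= e) ->
  has_int01 f b -> has_int01 g c -> `|b - c| <= e.
Proof.
move=> fge fb gc; have H := has_int01B fb gc.
rewrite ler_norml; apply/andP; split.
  apply: le_has_int01 (has_int01_cst _) H => x /fge.
  by rewrite ler_norml => /andP[].
apply: le_has_int01 H (has_int01_cst _) => x /fge.
by rewrite ler_norml => /andP[].
Qed.

(** Integrability of the limit is part of the conclusion: [f] is measurable as a pointwise limit,
    and it differs from the integrable [fn 0] by a function bounded by [e 0]. *)
Lemma has_int01_unif_lim (fn : nat -> R -> R) (cn e : nat -> R) f :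
  (forall n, has_int01 (fn n) (cn n)) ->
  (forall n x, 0 < x < 1 -> `|f x - fn n x| <= e n) ->
  e n @[n --> \oo] --> 0 ->
  exists2 c, has_int01 f c & forall n, `|c - cn n| <= e n.
Proof.
move=> Hn fe e0.
have mf : measurable_fun (`]0%R, 1%R[ : set R) f.
  apply: (@measurable_fun_cvg _ _ _ _ fn) => [n|x /=].
    by apply/measurable_EFinP; have [/measurable_int] := Hn n.
  rewrite in_itv/= => x01; apply/cvgrPdist_le => d d0.
  move/cvgr0Pnorm_le : e0 => /(_ _ d0); apply: filterS => n; apply: le_trans.
  by apply: le_trans (ler_norm _); exact: fe.
have fi : mu.-integrable `]0%R, 1%R[ (EFin \o f).
  have [f0i _] := Hn 0.
  have mf0 : measurable_fun (`]0%R, 1%R[ : set R) (fn 0).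
    by apply/measurable_EFinP; exact: measurable_int f0i.
  have di : mu.-integrable `]0%R, 1%R[ (EFin \o (fun x => f x - fn 0 x)).
    apply: measurable_bounded_integrable => //.
    - by rewrite [ltLHS](lebesgue_measure_itv (`]0, 1[ : interval R))/= lte01 -EFinB ltry.
    - exact: measurable_funB.
    - exists (e 0); split; first exact: num_real.
      move=> M eM x /=; rewrite in_itv/= => /fe x01; exact: le_trans (x01 0) (ltW eM).
  apply: eq_integrable (integrableD _ f0i di) => // x _ /=.
  by rewrite -EFinD subrKC.
have Hf : has_int01 f (\int[lebesgue_measure]_(x in `]0%R, 1%R[) f x) by split.
exists (\int[lebesgue_measure]_(x in `]0%R, 1%R[) f x) => // n.
by apply: dist_has_int01 Hf (Hn n) => x; exact: fe.
Qed.

End HasInt01.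

(** * Trigonometric integrals *)

Section TrigIntegrals.
Variable R : realType.
Implicit Types (c x : R) (k l : nat).

Definition freq k : R := 2 * pi * k%:R.

Lemma freqD k l : freq (k + l) = freq k + freq l.
Proof. by rewrite /freq natrD mulrDr. Qed.

Lemma freq_gt0 k : (0 < k)%N -> 0 < freq k.
Proof. by move=> k0; rewrite /freq !mulr_gt0// ?pi_gt0// ltr0n. Qed.

(** Distinct indices have distinct frequencies, so the orthogonality relations may divide by
    [freq k - freq l]. *)
Lemma freq_inj : injective freq.
Proof.
move=> k l /mulfI; rewrite mulf_neq0 ?pnatr_eq0 ?gt_eqF ?pi_gt0// => /(_ isT).
by move/eqP; rewrite eqr_nat => /eqP.
Qed.

Lemma sin_cos_freq k : sin (freq k) = 0 /\ cos (freq k) = 1.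
Proof.
elim: k => [|k [IHs IHc]]; first by rewrite /freq mulr0 sin0 cos0.
have f1 : freq 1 = pi *+ 2 by rewrite /freq mulr1 mulr_natl.
by rewrite -addn1 freqD f1 sinD2pi cosD2pi.
Qed.

Lemma is_derive_mull c x : is_derive x (1 : R) (fun y => c * y) c.
Proof. by apply: is_derive_eq; rewrite [LHS]mulr1. Qed.

Lemma is_derive_sinM c x :
  is_derive x (1 : R) (fun y => sin (c * y)) (c * cos (c * x)).
Proof.
have := @is_derive1_comp _ sin (fun y => c * y) x _ _
  (is_derive_sin _) (is_derive_mull c x).
by rewrite mulrC.
Qed.

Lemma is_derive_cosM c x :
  is_derive x (1 : R) (fun y => cos (c * y)) (- (c * sin (c * x))).
Proof.
have := @is_derive1_comp _ cos (fun y => c * y) x _ _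
  (is_derive_cos _) (is_derive_mull c x).
by rewrite mulNr mulrC.
Qed.

Lemma continuous_sinM c : continuous (fun x : R => sin (c * x)).
Proof.
move=> x; apply: continuous_comp; last exact: continuous_sin.
by apply: cvgMr; exact: cvg_id.
Qed.

Lemma continuous_cosM c : continuous (fun x : R => cos (c * x)).
Proof.
move=> x; apply: continuous_comp; last exact: continuous_cos.
by apply: cvgMr; exact: cvg_id.
Qed.

Lemma has_int01_cos c : c != 0 -> has_int01 (fun x => cos (c * x)) (sin c / c).
Proof.
move=> c0; have -> : sin c / c = sin (c * 1) / c - sin (c * 0) / c.
  by rewrite mulr1 mulr0 sin0 mul0r subr0.
apply: (@has_int01_FTC _ (fun x => sin (c * x) / c)); last exact: continuous_cosM.
move=> x; have H := is_deriveZ c^-1 (is_derive_sinM c x).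
rewrite (_ : (fun y => _) = c^-1 \*: (fun y => sin (c * y))); last first.
  by apply/funext => y /=; rewrite mulrC.
by apply: is_derive_eq; rewrite [LHS]mulrA mulVf// mul1r.
Qed.

Lemma has_int01_sin c : c != 0 ->
  has_int01 (fun x => sin (c * x)) ((1 - cos c) / c).
Proof.
move=> c0.
have -> : (1 - cos c) / c = - (cos (c * 1) / c) - - (cos (c * 0) / c).
  by rewrite mulr1 mulr0 cos0; field.
apply: (@has_int01_FTC _ (fun x => - (cos (c * x) / c))); last exact: continuous_sinM.
move=> x; have H := is_deriveZ (- c^-1) (is_derive_cosM c x).
rewrite (_ : (fun y => _) = - c^-1 \*: (fun y => cos (c * y))); last first.
  by apply/funext => y /=; rewrite [RHS]mulNr mulrC.
by apply: is_derive_eq; rewrite [LHS]mulrNN mulrA mulVf// mul1r.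
Qed.

Lemma has_int01_id_sin c : c != 0 ->
  has_int01 (fun x => x * sin (c * x)) (sin c / c ^+ 2 - cos c / c).
Proof.
(* Integration by parts yields this antiderivative. Such integrals arise when the factor [u] from
   differentiating [u * v] meets a trigonometric term. *)
move=> c0; pose F x := sin (c * x) / c ^+ 2 - x * cos (c * x) / c.
have -> : sin c / c ^+ 2 - cos c / c = F 1 - F 0.
  by rewrite /F !mulr1 mulr0 !mul0r sin0 mul1r; field.
apply: has_int01_FTC => x; last first.
  by apply: cvgM; [exact: cvg_id|exact: continuous_sinM].
have H := is_deriveB (is_deriveZ (c ^- 2) (is_derive_sinM c x))
  (is_deriveZ c^-1 (is_deriveM (is_derive_id x 1) (is_derive_cosM c x))).
have -> : F = c ^- 2 \*: (fun y => sin (c * y)) - c^-1 \*: (id * (fun y => cos (c * y))).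
  by apply/funext => y; rewrite /F /=; congr (_ - _); [rewrite mulrC|rewrite mulrC].
apply: is_derive_eq.
by rewrite /GRing.scale/=; field.
Qed.

Lemma has_int01_id_cos_freq k : (0 < k)%N ->
  has_int01 (fun x => x * cos (freq k * x)) 0.
Proof.
move=> k0; have c0 := lt0r_neq0 (freq_gt0 k0); set c := freq k in c0 *.
pose F x := x * sin (c * x) / c + cos (c * x) / c ^+ 2.
have -> : 0 = F 1 - F 0.
  by rewrite /F !mulr1 !mulr0 !mul0r cos0 (sin_cos_freq k).1 (sin_cos_freq k).2; ring.
apply: has_int01_FTC => x; last first.
  by apply: cvgM; [exact: cvg_id|exact: continuous_cosM].
have H := is_deriveD (is_deriveZ c^-1 (is_deriveM (is_derive_id x 1) (is_derive_sinM c x)))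
  (is_deriveZ (c ^- 2) (is_derive_cosM c x)).
have -> : F = c^-1 \*: (id * (fun y => sin (c * y))) + c ^- 2 \*: (fun y => cos (c * y)).
  by apply/funext => y; rewrite /F /=; congr (_ + _); rewrite mulrC.
by apply: is_derive_eq; rewrite /GRing.scale/=; field.
Qed.

Lemma has_int01_id : has_int01 (fun x : R => x) (1 / 2).
Proof.
have -> : 1 / 2 = 1 / 2 * 1 ^+ 2 - 1 / 2 * 0 ^+ 2 :> R.
  by rewrite expr0n /= mulr0 subr0 expr1n mulr1.
apply: (@has_int01_FTC _ (fun x => 1 / 2 * x ^+ 2)); last by move=> x; exact: cvg_id.
by move=> x; apply: is_derive_eq; rewrite /GRing.scale/=; field.
Qed.

Lemma has_int01_cos_freq k : (0 < k)%N -> has_int01 (fun x => cos (freq k * x)) 0.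
Proof.
move=> k0; have := has_int01_cos (lt0r_neq0 (freq_gt0 k0)).
by rewrite (sin_cos_freq k).1 mul0r.
Qed.

Lemma has_int01_sin_freq k : has_int01 (fun x => sin (freq k * x)) 0.
Proof.
case: k => [|k].
  by apply: eq_has_int01 (has_int01_cst 0) => x _; rewrite /freq mulr0 mul0r sin0.
have := has_int01_sin (lt0r_neq0 (freq_gt0 (ltn0Sn k))).
by rewrite (sin_cos_freq k.+1).2 subrr mul0r.
Qed.

Lemma has_int01_id_sin_freq k : (0 < k)%N ->
  has_int01 (fun x => x * sin (freq k * x)) (- (freq k)^-1).
Proof.
move=> k0; have := has_int01_id_sin (lt0r_neq0 (freq_gt0 k0)).
by rewrite (sin_cos_freq k).1 (sin_cos_freq k).2 mul0r sub0r mul1r.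
Qed.

Lemma has_int01_cos_freqB k l :
  has_int01 (fun x => cos ((freq k - freq l) * x)) (k == l)%:R.
Proof.
case: eqVneq => [->|kl].
  by apply: eq_has_int01 (has_int01_cst 1) => x _; rewrite subrr mul0r cos0.
have kl0 : freq k - freq l != 0 by rewrite subr_eq0 (inj_eq freq_inj).
have := has_int01_cos kl0.
by rewrite sinB (sin_cos_freq k).1 (sin_cos_freq l).1 mul0r mulr0 subrr mul0r.
Qed.

Lemma has_int01_sin_freqB k l :
  has_int01 (fun x => sin ((freq k - freq l) * x)) 0.
Proof.
have [->|kl] := eqVneq k l.
  by apply: eq_has_int01 (has_int01_cst 0) => x _; rewrite subrr mul0r sin0.
have kl0 : freq k - freq l != 0 by rewrite subr_eq0 (inj_eq freq_inj).
have := has_int01_sin kl0.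
rewrite cosB (sin_cos_freq k).1 (sin_cos_freq l).1 (sin_cos_freq k).2 (sin_cos_freq l).2.
by rewrite mulr0 addr0 mulr1 subrr mul0r.
Qed.

(** Product-to-sum formulas leave the frequencies of [k - l] and [k + l]; the latter is nonzero
    because [k > 0], so only [k = l] contributes. *)
Lemma has_int01_coscos k l : (0 < k)%N ->
  has_int01 (fun x => cos (freq k * x) * cos (freq l * x)) ((k == l)%:R / 2).
Proof.
move=> k0; have kl0 : (0 < k + l)%N by rewrite addn_gt0 k0.
have := has_int01Z 2^-1 (has_int01D (has_int01_cos_freqB k l) (has_int01_cos_freq kl0)).
rewrite addr0 mulrC; apply: eq_has_int01 => x _.
by rewrite freqD mulrBl mulrDl cosB cosD; field.
Qed.

Lemma has_int01_sinsin k l : (0 < k)%N ->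
  has_int01 (fun x => sin (freq k * x) * sin (freq l * x)) ((k == l)%:R / 2).
Proof.
move=> k0; have kl0 : (0 < k + l)%N by rewrite addn_gt0 k0.
have := has_int01Z 2^-1 (has_int01B (has_int01_cos_freqB k l) (has_int01_cos_freq kl0)).
rewrite subr0 mulrC; apply: eq_has_int01 => x _.
by rewrite freqD mulrBl mulrDl cosB cosD; field.
Qed.

Lemma has_int01_cossin k l :
  has_int01 (fun x => cos (freq k * x) * sin (freq l * x)) 0.
Proof.
have := has_int01Z 2^-1
  (has_int01B (has_int01_sin_freq (k + l)) (has_int01_sin_freqB k l)).
rewrite subrr mulr0; apply: eq_has_int01 => x _.
by rewrite freqD mulrBl mulrDl sinB sinD; field.
Qed.

End TrigIntegrals.

(** * Dominated series *)

Section DominatedSeries.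
Variables (R : realType) (a : nat -> R).
Hypothesis cvga : cvgn (fun n => \sum_(1 <= k < n) a k).
Implicit Types (w z : nat -> R) (M : R) (n : nat).

(** The common yardstick: every truncation error below is a constant times this remainder. *)
Let tail n : R := \sum_(1 <= k <oo) a k - \sum_(1 <= k < n) a k.

Lemma cvg_tail0 : tail n @[n --> \oo] --> 0.
Proof.
rewrite -(subrr (\sum_(1 <= k <oo) a k)).
by apply: cvgB; [exact: cvg_cst|exact: cvga].
Qed.

Lemma cvg_dominated w M : (forall k, (0 < k)%N -> `|w k| <= M * a k) ->
  cvgn (fun n => \sum_(1 <= k < n) w k).
Proof.
move=> wa.
(* Index 0 is not covered by the hypothesis; the factor [(0 < k)%:R] annihilates it, so that the
   comparison test for series starting at 0 applies. *)
have sum1E z n : \sum_(1 <= k < n) z k = \sum_(1 <= k < n) (0 < k)%:R * z k.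
  by rewrite big_nat [RHS]big_nat; apply: eq_bigr => k /andP[-> _]; rewrite mul1r.
have : cvgn (fun n => \sum_(1 <= k < n) (0 < k)%:R * (M * a k)).
  rewrite (_ : (fun n => _) = (fun n => M * \sum_(1 <= k < n) a k)).
    by apply: is_cvgMr; exact: cvga.
  by apply/funext => n; rewrite -sum1E mulr_sumr.
rewrite (is_cvg_series_restrict 1) => cM.
rewrite (_ : (fun n => _) = (fun n => \sum_(1 <= k < n) (0 < k)%:R * w k)); last first.
  by apply/funext => n; exact: sum1E.
rewrite (is_cvg_series_restrict 1); apply: normed_cvg; apply: series_le_cvg cM => k.
- exact: normr_ge0.
- case: k => [|k]; first by rewrite mul0r.
  by rewrite ltn0Sn mul1r (le_trans _ (wa k.+1 _)).
- rewrite /=; case: posnP => [_|k0]; first by rewrite !mul0r normr0.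
  by rewrite !mul1r wa.
Qed.

(** The triangle inequality bounds each block of indices from [n] to [m]; then [m] tends to
    infinity. *)
Lemma tail_dominated w M n : (forall k, (0 < k)%N -> `|w k| <= M * a k) ->
  `|\sum_(1 <= k <oo) w k - \sum_(1 <= k < n) w k| <= M * tail n.
Proof.
(* For [n = 0] and [n = 1] both partial sums are empty, so [n] may be taken positive, as splitting
   the sum over [1 <= k < m] at [n] requires. *)
move=> wa; wlog n0 : n / (0 < n)%N => [H|].
  case: n => [|n]; last exact: H.
  by have := H 1 isT; rewrite /tail !big_geq.
have cw := cvg_dominated wa.
have cl : `|\sum_(1 <= k < m) w k - \sum_(1 <= k < n) w k| @[m --> \oo] -->
    `|\sum_(1 <= k <oo) w k - \sum_(1 <= k < n) w k|.
  by apply: cvg_norm; apply: cvgB; [exact: cw|exact: cvg_cst].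
have cr : M * (\sum_(1 <= k < m) a k - \sum_(1 <= k < n) a k) @[m --> \oo] -->
    M * tail n.
  by apply: cvgMr; apply: cvgB; [exact: cvga|exact: cvg_cst].
apply: (ler_cvg_to cl cr); near=> m.
have nm : (n <= m)%N by near: m; exact: nbhs_infty_ge.
rewrite !(@big_cat_nat _ _ _ n 1 m)//= [X in `|X|]addrAC subrr add0r.
rewrite [X in M * X]addrAC subrr add0r.
apply: le_trans (ler_norm_sum _ _ _) _; rewrite mulr_sumr big_nat [leRHS]big_nat.
by apply: ler_sum => k /andP[nk _]; apply: wa; exact: leq_trans nk.
Unshelve. all: by end_near. Qed.

Lemma norm_sum_dominated w M : (forall k, (0 < k)%N -> `|w k| <= M * a k) ->
  `|\sum_(1 <= k <oo) w k| <= M * \sum_(1 <= k <oo) a k.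
Proof.
move=> wa; have := tail_dominated 0 wa.
by rewrite /tail !(@big_geq _ _ _ 1 0)// !subr0.
Qed.

(** The tail estimate applied to [a] itself: the tail dominates a norm, hence is nonnegative. *)
Lemma psum_le n : (forall k, 0 <= a k) ->
  \sum_(1 <= k < n) a k <= \sum_(1 <= k <oo) a k.
Proof.
move=> a_ge0; rewrite -subr_ge0 -[leRHS]mul1r.
apply: le_trans (tail_dominated (w := a) (M := 1) n _) => // k k0.
by rewrite mul1r ger0_norm.
Qed.

(* A summable quadratic bound on the first-order remainders of the terms passes
   to the sum, so no uniform convergence theorem for derivatives is needed. *)
Lemma is_derive_dominated (w d : nat -> R -> R) M1 M2 M3 (x : R) :
  (forall k y, (0 < k)%N -> `|w k y| <= M1 * a k) ->
  (forall k y, (0 < k)%N -> `|d k y| <= M2 * a k) ->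
  (forall k h, (0 < k)%N ->
    `|w k (x + h) - w k x - h * d k x| <= M3 * h ^+ 2 * a k) ->
  is_derive x (1 : R) (fun y => \sum_(1 <= k <oo) w k y) (\sum_(1 <= k <oo) d k x).
Proof.
move=> wa da wd.
set W := fun y => _; set D := (X in is_derive _ _ _ X).
set A := \sum_(1 <= k <oo) a k.
(* The first-order remainder of the sum is the sum of the remainders, bounded term by term. *)
have quad h : `|W (x + h) - W x - h * D| <= M3 * h ^+ 2 * A.
  rewrite (_ : _ - _ = \sum_(1 <= k <oo) (w k (x + h) - w k x - h * d k x)).
    by apply: norm_sum_dominated => k /wd.
  apply/esym/cvg_lim => //.
  rewrite (_ : (fun n => _) = fun n => \sum_(1 <= k < n) w k (x + h)
     - \sum_(1 <= k < n) w k x - h * \sum_(1 <= k < n) d k x); last first.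
    by apply/funext => n; rewrite mulr_sumr -!sumrB.
  apply: cvgB; first by apply: cvgB; apply: cvg_dominated => k /wa.
  by apply: cvgMr; apply: cvg_dominated => k /da.
have dW : h^-1 *: (W (h *: (1 : R) + x) - W x) @[h --> 0^'] --> D.
  apply/cvgrPdist_le => e e0.
  (* Adding 1 keeps the divisor positive even when [M3 * A] vanishes. *)
  have B0 : 0 < `|M3 * A| + 1 by rewrite ltr_wpDl.
  near=> h.
  have h0 : h != 0 by near: h; exact: nbhs_dnbhs_neq.
  have -> : D - h^-1 *: (W (h *: (1 : R) + x) - W x) =
      - (h^-1 * (W (x + h) - W x - h * D)).
    rewrite [h *: _]mulr1 [h + x]addrC /GRing.scale/=; field.
    exact: h0.
  rewrite normrN normrM normfV ler_pdivrMl ?normr_gt0//.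
  apply: le_trans (quad h) _.
  have -> : M3 * h ^+ 2 * A = h * (h * (M3 * A)) by ring.
  rewrite (le_trans (ler_norm _))// normrM ler_wpM2l// normrM.
  rewrite (@le_trans _ _ (`|h| * (`|M3 * A| + 1)))//; first by rewrite ler_wpM2l// lerDl.
  rewrite -ler_pdivlMr//; near: h; apply: dnbhs0_le.
  exact: divr_gt0.
by apply: DeriveDef; [apply/cvg_ex; exists D|apply: cvg_lim].
Unshelve. all: by end_near. Qed.

End DominatedSeries.

(** * Mean value theorem and first-order remainders *)

Section Taylor.
Variable R : realType.

(** Bounding the distance from [c] to [x] avoids ordering [x] and [y], since increments of either
    sign occur. *)
Lemma MVT_dist (f df : R -> R) (x y : R) :
  (forall z : R, is_derive z (1 : R) f (df z)) ->
  exists2 c, `|c - x| <= `|y - x| & f y - f x = df c * (y - x).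
Proof.
move=> fd.
have cf : continuous f.
  by move=> z; apply/differentiable_continuous/derivable1_diffP; have [] := fd z.
have [xy|/ltW yx] := leP x y.
  have [|c] := @MVT_segment R f df x y xy (fun z _ => fd z).
    exact: continuous_subspaceT.
  rewrite in_itv/= => /andP[xc cy] ->; exists c => //.
  by rewrite !ger0_norm ?subr_ge0 ?lerB.
have [|c] := @MVT_segment R f df y x yx (fun z _ => fd z).
  exact: continuous_subspaceT.
rewrite in_itv/= => /andP[yc cx] fE; exists c.
  by rewrite !ler0_norm ?subr_le0// lerN2 lerB.
by rewrite -opprB fE -mulrN opprB.
Qed.

(** Two mean value steps give the constant [B] instead of the sharp [B / 2], which is enough for
    differentiating the series. *)
Lemma taylor1_le (f f1 f2 : R -> R) (B x h : R) :
  (forall z : R, is_derive z (1 : R) f (f1 z)) ->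
  (forall z : R, is_derive z (1 : R) f1 (f2 z)) ->
  (forall z, `|f2 z| <= B) ->
  `|f (x + h) - f x - h * f1 x| <= B * h ^+ 2.
Proof.
move=> df df1 fB.
have [c cx ->] := MVT_dist x (x + h) df.
have [c' _ fc] := MVT_dist x c df1.
have xh : x + h - x = h by ring.
rewrite xh in cx *.
have -> : f1 c * h - h * f1 x = f2 c' * ((c - x) * h) by rewrite mulrA -fc; ring.
rewrite -real_normK ?num_real// expr2 normrM ler_pM// normrM.
by rewrite ler_wpM2r.
Qed.

End Taylor.

(** * Trigonometric sums *)

(** Uniform convergence is used twice, first in [u] for fixed [v], then in [v]; the inner integrals
    inherit the error [e n]. The estimate is asked only on the open square, away from junk values on
    the boundary. *)
Lemma cvg_double_int01 (R : realType) (f : R -> R -> R) (fn : nat -> R -> R -> R)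
    (inn : nat -> R -> R) (c e : nat -> R) :
  (forall n v, has_int01 (fun u => fn n u v) (inn n v)) ->
  (forall n, has_int01 (inn n) (c n)) ->
  (forall n u v, 0 < u < 1 -> 0 < v < 1 -> `|f u v - fn n u v| <= e n) ->
  e n @[n --> \oo] --> 0 ->
  c n @[n --> \oo] --> \int[lebesgue_measure]_(v in `[0%R, 1%R])
    (\int[lebesgue_measure]_(u in `[0%R, 1%R]) f u v).
Proof.
move=> Hin Hout fe e0.
set J := fun v => \int[lebesgue_measure]_(u in `[0%R, 1%R]) f u v.
have HJ n v : 0 < v < 1 -> `|J v - inn n v| <= e n.
  move=> v01.
  have [j Hj jc] := has_int01_unif_lim (fun m => Hin m v)
    (fun m u u01 => fe m u v u01 v01) e0.
  by rewrite /J (has_int01_Rintegral Hj); exact: jc.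
have [j Hj jc] := has_int01_unif_lim Hout HJ e0.
rewrite (has_int01_Rintegral Hj); apply/cvgrPdist_le => d d0.
move/cvgr0Pnorm_le : e0 => /(_ _ d0); apply: filterS => n; apply: le_trans.
exact: le_trans (jc n) (ler_norm _).
Qed.

Lemma sum_delta (R : pzRingType) (F : nat -> R) m n k : (m <= k < n)%N ->
  \sum_(m <= l < n) (k == l)%:R * F l = F k.
Proof.
move=> kn; rewrite (bigD1_seq k) ?mem_index_iota ?iota_uniq//= eqxx mul1r big1 ?addr0//.
by move=> l /negPf; rewrite eq_sym => ->; rewrite mul0r.
Qed.

Section TrigSums.
Variables (R : realType) (p q : nat -> R).
Implicit Types (u v x y : R) (k l n : nat).
Notation phi := (@freq R).

Definition trig_term k u v : R :=
  p k * sin (phi k * u) * sin (phi k * v) +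
  q k * (1 - cos (phi k * u)) * (1 - cos (phi k * v)).

(** The [u]-derivative of [trig_term]; by symmetry the [v]-derivative is [dtrig_term k v u]. *)
Definition dtrig_term k u v : R :=
  phi k * (p k * cos (phi k * u) * sin (phi k * v) +
           q k * sin (phi k * u) * (1 - cos (phi k * v))).

Lemma trig_termC k u v : trig_term k u v = trig_term k v u.
Proof. by rewrite /trig_term; ring. Qed.

Lemma norm_1Bcos x : `|1 - cos x| <= 2.
Proof.
apply: le_trans (ler_normB _ _) _; rewrite normr1.
by rewrite (_ : 2 = 1 + 1 :> R)// lerD2l cos_max.
Qed.

Lemma trig_term_le k u v : `|trig_term k u v| <= `|p k| + 4 * `|q k|.
Proof.
apply: le_trans (ler_normD _ _) _; apply: lerD.
  rewrite !normrM -mulrA ler_piMr// -[leRHS]mulr1 ler_pM ?sin_max//.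
rewrite !normrM (_ : 4 * _ = `|q k| * 2 * 2); last by ring.
by rewrite !ler_pM// ?mulr_ge0// norm_1Bcos.
Qed.

Lemma dtrig_term_le k u v :
  `|dtrig_term k u v| <= phi k * (`|p k| + 2 * `|q k|).
Proof.
have f0 : 0 <= phi k by rewrite /freq !mulr_ge0// pi_ge0.
rewrite normrM ger0_norm// ler_wpM2l//.
apply: le_trans (ler_normD _ _) _; apply: lerD.
  by rewrite !normrM -mulrA ler_piMr// -[leRHS]mulr1 ler_pM ?sin_max ?cos_max.
rewrite !normrM (_ : 2 * _ = `|q k| * 1 * 2); last by ring.
by rewrite !ler_pM// ?mulr_ge0// ?sin_max// norm_1Bcos.
Qed.

(** The second derivative costs [phi k ^+ 2], which the [1 / k^2] inside the coefficients will
    cancel, making the remainders summable. *)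
Lemma trig_term_taylor k u h v :
  `|trig_term k (u + h) v - trig_term k u v - h * dtrig_term k u v|
  <= phi k ^+ 2 * (`|p k| + 2 * `|q k|) * h ^+ 2.
Proof.
pose A := p k * sin (phi k * v); pose B := q k * (1 - cos (phi k * v)).
pose f x := A * sin (phi k * x) + B * (1 - cos (phi k * x)).
pose f1 x := phi k * (A * cos (phi k * x) + B * sin (phi k * x)).
pose f2 x := phi k ^+ 2 * (B * cos (phi k * x) - A * sin (phi k * x)).
have -> : trig_term k (u + h) v - trig_term k u v - h * dtrig_term k u v =
    f (u + h) - f u - h * f1 u.
  by rewrite /trig_term /dtrig_term /f /f1 /A /B; ring.
have AB : `|A| + `|B| <= `|p k| + 2 * `|q k|.
  rewrite !normrM lerD//; first by rewrite ler_piMr// sin_max.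
  by rewrite mulrC ler_wpM2r// norm_1Bcos.
apply: (@taylor1_le _ f f1 f2) => z.
- have S := is_deriveZ A (is_derive_sinM (phi k) z).
  have K := is_deriveZ B
    (is_deriveB (is_derive_cst (1 : R) z 1) (is_derive_cosM (phi k) z)).
  have -> : f = A \*: (fun y => sin (phi k * y)) +
      B \*: (cst 1 - (fun y => cos (phi k * y))).
    by apply/funext.
  by apply: is_derive_eq; rewrite /GRing.scale/= /f1; ring.
- have S := is_deriveZ (phi k * A) (is_derive_cosM (phi k) z).
  have K := is_deriveZ (phi k * B) (is_derive_sinM (phi k) z).
  have -> : f1 = (phi k * A) \*: (fun y => cos (phi k * y)) +
      (phi k * B) \*: (fun y => sin (phi k * y)).
    by apply/funext => y; rewrite /f1 [LHS]mulrDr !mulrA.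
  by apply: is_derive_eq; rewrite /GRing.scale/= /f2; ring.
- rewrite normrM ger0_norm ?sqr_ge0// ler_wpM2l ?sqr_ge0//.
  apply: le_trans AB; rewrite [leRHS]addrC; apply: le_trans (ler_normB _ _) _.
  by rewrite !normrM lerD// ler_piMr// ?sin_max ?cos_max.
Qed.

(** * Integrals of the partial sums of the copula *)

Definition trig_sum n u v : R := u * v + \sum_(1 <= k < n) trig_term k u v.

Lemma has_int01_trig_sum n v : has_int01 (fun u => trig_sum n u v)
  (v / 2 + \sum_(1 <= k < n) q k * (1 - cos (phi k * v))).
Proof.
apply: has_int01D.
  have := has_int01Z v (@has_int01_id R).
  by rewrite mul1r; apply: eq_has_int01 => x _; rewrite mulrC.
apply: has_int01_sum => k; rewrite mem_index_iota => /andP[k0 _].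
have S := has_int01Z (p k * sin (phi k * v)) (@has_int01_sin_freq R k).
have K := has_int01Z (q k * (1 - cos (phi k * v)))
  (has_int01B (has_int01_cst 1) (has_int01_cos_freq R k0)).
have := has_int01D S K; rewrite mulr0 add0r subr0 mulr1.
by apply: eq_has_int01 => x _; rewrite /trig_term; ring.
Qed.

Lemma has_int02_trig_sum n :
  has_int01 (fun v => v / 2 + \sum_(1 <= k < n) q k * (1 - cos (phi k * v)))
  (1 / 4 + \sum_(1 <= k < n) q k).
Proof.
apply: has_int01D.
  have := has_int01Z (1 / 2) (@has_int01_id R).
  rewrite (_ : 1 / 2 * (1 / 2) = 1 / 4); last by field.
  by apply: eq_has_int01 => x _; field.
apply: has_int01_sum => k; rewrite mem_index_iota => /andP[k0 _].
have := has_int01Z (q k) (has_int01B (has_int01_cst 1) (has_int01_cos_freq R k0)).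
by rewrite subr0 mulr1.
Qed.

(** * Integrals of the product of the two partial derivatives *)

Definition dtrig_sum n u v : R := v + \sum_(1 <= k < n) dtrig_term k u v.

(** The [u]-integral in closed form: [v / 2] comes from the product [v * u]; then each frequency
    contributes its pairing with [v], its pairing with [u], and its diagonal product. *)
Let inner n v : R := v / 2 + \sum_(1 <= k < n)
  (v * (phi k * q k * sin (phi k * v)) - q k * (1 - cos (phi k * v))
   + phi k ^+ 2 * p k * q k / 2 *
     ((1 - cos (phi k * v)) * cos (phi k * v) - sin (phi k * v) ^+ 2)).

Lemma has_int01_dtrig_prod n v :
  has_int01 (fun u => dtrig_sum n u v * dtrig_sum n v u) (inner n v).
Proof.
(* The product expands into four blocks, matched one by one with the summands of [inner]. *)
pose G u := v * u + \sum_(1 <= k < n) v * dtrig_term k v u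
  + \sum_(1 <= k < n) u * dtrig_term k u v
  + \sum_(1 <= k < n) \sum_(1 <= l < n) dtrig_term k u v * dtrig_term l v u.
have GE u : G u = dtrig_sum n u v * dtrig_sum n v u.
  have DE : \sum_(1 <= k < n) \sum_(1 <= l < n) dtrig_term k u v * dtrig_term l v u =
      (\sum_(1 <= k < n) dtrig_term k u v) * (\sum_(1 <= l < n) dtrig_term l v u).
    by rewrite mulr_suml; apply: eq_bigr => k _; rewrite mulr_sumr.
  by rewrite /G DE -!mulr_sumr /dtrig_sum; ring.
apply: (@eq_has_int01 _ G) => [u _|]; first exact: GE.
rewrite /inner big_split/= big_split/= !addrA.
apply: has_int01D; [apply: has_int01D; [apply: has_int01D|]|].
- by have := has_int01Z v (@has_int01_id R); rewrite mul1r.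
- apply: has_int01_sum => k; rewrite mem_index_iota => /andP[k0 _].
  have S := has_int01Z (v * phi k * p k * cos (phi k * v)) (@has_int01_sin_freq R k).
  have K := has_int01Z (v * phi k * q k * sin (phi k * v))
    (has_int01B (has_int01_cst 1) (has_int01_cos_freq R k0)).
  have := has_int01D S K.
  rewrite (_ : _ + _ = v * (phi k * q k * sin (phi k * v))).
    by apply: eq_has_int01 => x _; rewrite /dtrig_term; ring.
  by ring.
- apply: has_int01_sum => k; rewrite mem_index_iota => /andP[k0 _].
  have f0 := lt0r_neq0 (@freq_gt0 R k k0).
  have S := has_int01Z (phi k * q k * (1 - cos (phi k * v))) (has_int01_id_sin_freq R k0).
  have K := has_int01Z (phi k * p k * sin (phi k * v)) (has_int01_id_cos_freq R k0).
  have := has_int01D S K.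
  rewrite mulr0 addr0 (_ : _ * - _ = - (q k * (1 - cos (phi k * v)))).
    by apply: eq_has_int01 => x _; rewrite /dtrig_term; ring.
  by field.
- apply: has_int01_sum => k; rewrite mem_index_iota => kn.
  have /andP[k0 _] := kn.
  (* [X l] is the integral of the pair [(k, l)] stripped of its Kronecker factor; summing over [l]
     then leaves [X k]. *)
  pose X l := phi k * phi l / 2 * (q k * p l * (1 - cos (phi k * v)) * cos (phi l * v)
    - p k * q l * sin (phi k * v) * sin (phi l * v)).
  rewrite (_ : _ * _ = \sum_(1 <= l < n) (k == l)%:R * X l); last first.
    by rewrite sum_delta// /X; field.
  apply: has_int01_sum => l _.
  (* Of the four products, only cosine-cosine and sine-sine have a nonzero diagonal value; they
     carry the mixed coefficients [p k * q l] and [q k * p l]. *)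
  have cc := has_int01Z (phi k * phi l * p k * q l * sin (phi k * v) * sin (phi l * v))
    (has_int01B (has_int01_cos_freq R k0) (has_int01_coscos R l k0)).
  have cs := has_int01Z (phi k * phi l * p k * p l * sin (phi k * v) * cos (phi l * v))
    (has_int01_cossin R k l).
  have ss := has_int01Z (phi k * phi l * q k * p l * (1 - cos (phi k * v)) * cos (phi l * v))
    (has_int01_sinsin R l k0).
  have sc := has_int01Z (phi k * phi l * q k * q l * (1 - cos (phi k * v)) * sin (phi l * v))
    (has_int01B (has_int01_sin_freq R k) (has_int01_cossin R l k)).
  have := has_int01D (has_int01D cc cs) (has_int01D ss sc).
  rewrite (_ : _ + _ + _ = (k == l)%:R * X l); last by rewrite /X; field.
  by apply: eq_has_int01 => x _; rewrite /dtrig_term; ring.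
Qed.

(** Both linear contributions integrate to [- q k], whence [2 * q k]; the bracket of the diagonal
    one has mean [-1], half from the squared cosine and half from the squared sine. *)
Lemma has_int02_dtrig_prod n : has_int01 (inner n)
  (1 / 4 - \sum_(1 <= k < n) (2 * q k + phi k ^+ 2 * p k * q k / 2)).
Proof.
rewrite /inner -sumrN; apply: has_int01D.
  have := has_int01Z (1 / 2) (@has_int01_id R).
  rewrite (_ : 1 / 2 * (1 / 2) = 1 / 4); last by field.
  by apply: eq_has_int01 => x _; field.
apply: has_int01_sum => k; rewrite mem_index_iota => /andP[k0 _].
have f0 := lt0r_neq0 (@freq_gt0 R k k0).
have S := has_int01Z (phi k * q k) (has_int01_id_sin_freq R k0).
have H1 := has_int01B (has_int01_cst 1) (has_int01_cos_freq R k0).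
have H2 := has_int01B (has_int01_cos_freq R k0) (has_int01_coscos R k k0).
have H := has_int01D (has_int01B S (has_int01Z (q k) H1))
  (has_int01Z (phi k ^+ 2 * p k * q k / 2) (has_int01B H2 (has_int01_sinsin R k k0))).
rewrite eqxx mulr1n in H.
rewrite (_ : - _ = phi k * q k * - (phi k)^-1 - q k * (1 - 0) +
  phi k ^+ 2 * p k * q k / 2 * (0 - 1 / 2 - 1 / 2)); last by field.
by apply: eq_has_int01 H => x _; ring.
Qed.

End TrigSums.

(** * The trigonometric copula *)

Section TrigCopulaSeries.
Variables (R : realType) (lambda mu : nat -> R).
Hypothesis Hsum :
  (\sum_(1 <= k <oo) (`|lambda k| + `|mu k|)%:E <= (1 / 2)%:E)%E.
Implicit Types (u v x : R) (n k : nat).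

Let a k : R := `|lambda k| + `|mu k|.

Let a_ge0 k : 0 <= a k. Proof. by rewrite addr_ge0. Qed.

(** The hypothesis is an inequality between extended reals; monotone partial sums bounded by [1 / 2]
    turn it into convergence of a real series. *)
Let cvga : cvgn (fun n => \sum_(1 <= k < n) a k).
Proof.
apply: nondecreasing_is_cvgn; first by apply: nondecreasing_series => k _ _.
exists (1 / 2) => _ [n _ <-]; rewrite -lee_fin -sumEFin; apply: le_trans Hsum.
by apply: nneseries_lim_ge => k _ _; rewrite lee_fin a_ge0.
Qed.

Let A_le : \sum_(1 <= k <oo) a k <= 1 / 2.
Proof.
apply: limr_le; first exact: cvga.
near=> n; rewrite -lee_fin -sumEFin; apply: le_trans Hsum.
by apply: nneseries_lim_ge => k _ _; rewrite lee_fin a_ge0.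
Unshelve. all: by end_near. Qed.

(** Absorbs both [1 / (2 pi^2)] and [1 / k^2], so that the two series of [trig_copula] merge into
    one series of [trig_term]. *)
Definition scaled (w : nat -> R) k : R := w k / (2 * pi ^+ 2 * k%:R ^+ 2).

Let p := scaled lambda.
Let q := scaled mu.
Let T k u v := trig_term p q k u v.
Let D k u v := dtrig_term p q k u v.

Let den_ge0 k : 0 <= 2 * pi ^+ 2 * k%:R ^+ 2 :> R.
Proof. by apply: mulr_ge0; [apply: mulr_ge0|]; rewrite ?sqr_ge0. Qed.

Let norm_scaled w k : `|scaled w k| = `|w k| / (2 * pi ^+ 2 * k%:R ^+ 2).
Proof. by rewrite normrM normfV (ger0_norm (den_ge0 k)). Qed.

Let pq_le k : `|p k| + 2 * `|q k| <= 2 * a k / (2 * pi ^+ 2 * k%:R ^+ 2).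
Proof.
rewrite !norm_scaled mulrA -mulrDl ler_wpM2r ?invr_ge0//.
by rewrite /a; have := normr_ge0 (lambda k); lra.
Qed.

Let pi_ge1 : 1 <= pi :> R.
Proof. by apply: le_trans (pi_ge2 R); rewrite ler1n. Qed.

Let den_ge1 k : (0 < k)%N -> 1 <= 2 * pi ^+ 2 * k%:R ^+ 2 :> R.
Proof.
move=> k0; have k1 : 1 <= k%:R :> R by rewrite ler1n.
rewrite -[leLHS]mulr1 ler_pM ?exprn_ege1// -[leLHS]mulr1 ler_pM ?exprn_ege1//.
by rewrite ler1n.
Qed.

Let T_le k u v : (0 < k)%N -> `|T k u v| <= 4 * a k.
Proof.
move=> k0; apply: le_trans (trig_term_le _ _ _ _ _) _.
have d1 := den_ge1 k0; have d0 := lt_le_trans ltr01 d1.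
rewrite !norm_scaled mulrA -mulrDl ler_pdivrMr//.
apply: (@le_trans _ _ (4 * a k)); last by rewrite ler_peMr// mulr_ge0.
by rewrite /a; have := normr_ge0 (lambda k); lra.
Qed.

(** One factor [2 pi k] against [2 pi^2 k^2] leaves [1 / (pi k)], which is at most 1. *)
Let D_le k u v : (0 < k)%N -> `|D k u v| <= 2 * a k.
Proof.
move=> k0; apply: le_trans (dtrig_term_le _ _ _ _ _) _.
have k1 : 1 <= k%:R :> R by rewrite ler1n.
have pk : 1 <= pi * k%:R :> R by rewrite -[leLHS]mulr1 ler_pM ?pi_ge1.
apply: le_trans (_ : freq R k * (2 * a k / (2 * pi ^+ 2 * k%:R ^+ 2)) <= _).
  by rewrite ler_wpM2l ?pq_le// ltW// freq_gt0.
rewrite (_ : freq R k * _ = 2 * a k / (pi * k%:R)); last first.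
  (* [pi] is generalised to a positive variable so that [field] treats it as an atom. *)
  rewrite /freq; move: (@pi R) (pi_gt0 R) => P P0; field.
  by rewrite !gt_eqF ?ltr0n.
by rewrite ler_pdivrMr ?ler_peMr ?mulr_ge0// (lt_le_trans ltr01).
Qed.

(** Here the cancellation is exact: [(2 pi k)^2] over [2 pi^2 k^2] is 2, so the constant 4 does not
    depend on [k]. *)
Let T_taylor k u h v : (0 < k)%N ->
  `|T k (u + h) v - T k u v - h * D k u v| <= 4 * h ^+ 2 * a k.
Proof.
move=> k0; apply: le_trans (trig_term_taylor _ _ _ _ _ _) _.
rewrite (_ : 4 * _ * _ = freq R k ^+ 2 * (2 * a k / (2 * pi ^+ 2 * k%:R ^+ 2)) * h ^+ 2).
  by rewrite ler_wpM2r ?sqr_ge0// ler_wpM2l ?sqr_ge0 ?pq_le.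
rewrite /freq; move: (@pi R) (pi_gt0 R) => P P0; field.
by rewrite !gt_eqF ?ltr0n.
Qed.

Let w_div_sqr_le (w : nat -> R) k : (0 < k)%N -> `|w k / k%:R ^+ 2| <= `|w k|.
Proof.
move=> k0; have k1 : 1 <= k%:R :> R by rewrite ler1n.
rewrite normrM ler_piMr// ger0_norm ?invr_ge0 ?sqr_ge0//.
by rewrite invf_le1 ?exprn_gt0 ?ltr0n// exprn_ege1.
Qed.

Lemma trig_copulaE u v :
  trig_copula lambda mu u v = u * v + \sum_(1 <= k <oo) T k u v.
Proof.
rewrite /trig_copula -addrA; congr (_ + _); apply/esym/cvg_lim => //.
pose P k := lambda k / k%:R ^+ 2 * sin (2 * pi * k%:R * u) * sin (2 * pi * k%:R * v).
pose Q k := mu k / k%:R ^+ 2 * (1 - cos (2 * pi * k%:R * u)) * (1 - cos (2 * pi * k%:R * v)).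
rewrite (_ : (fun n => _) = fun n => 1 / (2 * pi ^+ 2) * \sum_(1 <= k < n) P k
    + 1 / (2 * pi ^+ 2) * \sum_(1 <= k < n) Q k); last first.
  apply/funext => n; rewrite -mulrDr -big_split/= mulr_sumr big_nat [RHS]big_nat.
  apply: eq_bigr => k /andP[k0 _].
  rewrite /T /trig_term /P /Q /p /q /scaled /freq.
  move: (@pi R) (pi_gt0 R) => P' P'0; field.
  by rewrite !gt_eqF ?ltr0n.
have sin1 y : `|sin y| <= 1 :> R by exact: sin_max.
(* Both series must converge separately before their limits can be added. *)
have cP : cvgn (fun n => \sum_(1 <= k < n) P k).
  apply: (cvg_dominated cvga (M := 1)) => k k0; rewrite mul1r 2!normrM.
  apply: (@le_trans _ _ `|lambda k|); last by rewrite lerDl.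
  by rewrite -mulrA (le_trans _ (w_div_sqr_le _ k0))// ler_piMr// -[leRHS]mulr1 ler_pM.
have cQ : cvgn (fun n => \sum_(1 <= k < n) Q k).
  apply: (cvg_dominated cvga (M := 4)) => k k0; rewrite 2!normrM.
  apply: (@le_trans _ _ (`|mu k| * (2 * 2))); last first.
    by rewrite mulrC -natrM ler_wpM2l// lerDr.
  by rewrite -mulrA ler_pM// ?mulr_ge0// ?w_div_sqr_le// ler_pM// norm_1Bcos.
by apply: cvgD; apply: cvgMr; [exact: cP|exact: cQ].
Qed.

(** Symmetry turns [partial2] into [partial1] with exchanged arguments. *)
Lemma trig_copulaC u v : trig_copula lambda mu u v = trig_copula lambda mu v u.
Proof.
rewrite !trig_copulaE mulrC; congr (_ + limn _).
by apply/funext => n; apply: eq_bigr => k _; exact: trig_termC.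
Qed.

Let G u v : R := v + \sum_(1 <= k <oo) D k u v.

Lemma is_derive_trig_copula u v :
  is_derive u (1 : R) (fun x => trig_copula lambda mu x v) (G u v).
Proof.
have Hs : is_derive u (1 : R) (fun x => \sum_(1 <= k <oo) T k x v)
    (\sum_(1 <= k <oo) D k u v).
  apply: (is_derive_dominated cvga (w := fun k x => T k x v) (d := fun k x => D k x v)
    (M1 := 4) (M2 := 2) (M3 := 4)).
  - by move=> k y k0; exact: T_le.
  - by move=> k y k0; exact: D_le.
  - by move=> k h k0; exact: T_taylor.
have -> : (fun x => trig_copula lambda mu x v) =
    (fun x => v * x) + (fun x => \sum_(1 <= k <oo) T k x v).
  by apply/funext => x; rewrite trig_copulaE mulrC.
exact: is_deriveD (is_derive_mull v u) Hs.
Qed.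

Lemma partial1_trig (C : R -> R -> R) :
  (forall u v, u \in `[0, 1] -> v \in `[0, 1] -> C u v = trig_copula lambda mu u v) ->
  forall u v, 0 < u < 1 -> 0 < v < 1 -> partial1 C u v = G u v.
Proof.
move=> CE u v u01 v01; rewrite /partial1 derive1E.
have [_ <-] := is_derive_trig_copula u v.
have v01' : v \in `[0, 1] by rewrite in_itv/=; case/andP: v01 => /ltW -> /ltW ->.
(* [C] is known only on the square, so equality of the derivatives comes from a neighbourhood of [u]
   inside the open interval. *)
apply: near_eq_derive; near=> x; apply: CE => //.
have : x \in `]0, 1[ by near: x; apply: near_in_itvoo; rewrite in_itv.
by rewrite !in_itv/= => /andP[/ltW -> /ltW ->].
Unshelve. all: by end_near. Qed.

Let tail n : R := \sum_(1 <= k <oo) a k - \sum_(1 <= k < n) a k.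

Lemma spearman_cvg (C : R -> R -> R) :
  (forall u v, u \in `[0, 1] -> v \in `[0, 1] -> C u v = trig_copula lambda mu u v) ->
  1 / 4 + \sum_(1 <= k < n) q k @[n --> \oo] -->
  \int[lebesgue_measure]_(v in `[0%R, 1%R])
    (\int[lebesgue_measure]_(u in `[0%R, 1%R]) C u v).
Proof.
move=> CE.
apply: (cvg_double_int01 (fn := trig_sum p q) (e := fun n => 4 * tail n)).
- by move=> n v; exact: has_int01_trig_sum.
- by move=> n; exact: has_int02_trig_sum.
- move=> n u v /andP[/ltW u0 /ltW u1] /andP[/ltW v0 /ltW v1].
  rewrite CE ?in_itv/= ?u0 ?v0// trig_copulaE /trig_sum.
  rewrite opprD addrACA subrr add0r.
  by apply: (tail_dominated cvga) => k; exact: T_le.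
- by rewrite -[0](mulr0 4); apply: cvgMr; exact: cvg_tail0.
Qed.

Lemma kendall_cvg (C : R -> R -> R) :
  (forall u v, u \in `[0, 1] -> v \in `[0, 1] -> C u v = trig_copula lambda mu u v) ->
  1 / 4 - \sum_(1 <= k < n) (2 * q k + freq R k ^+ 2 * p k * q k / 2) @[n --> \oo] -->
  \int[lebesgue_measure]_(v in `[0%R, 1%R])
    (\int[lebesgue_measure]_(u in `[0%R, 1%R]) (partial1 C u v * partial2 C u v)).
Proof.
move=> CE.
have p2 u v : 0 < u < 1 -> 0 < v < 1 -> partial2 C u v = G v u.
  move=> u01 v01; rewrite -(@partial1_trig (fun x y => C y x))// => x y x01 y01.
  by rewrite CE// trig_copulaC.
pose Gn := dtrig_sum p q.
have tail_ge0 n : 0 <= tail n by rewrite subr_ge0 psum_le.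
have GGn n u v : `|G u v - Gn n u v| <= 2 * tail n.
  rewrite /G /Gn /dtrig_sum opprD addrACA subrr add0r.
  by apply: (tail_dominated cvga) => k; exact: D_le.
(* The linear part is at most 1, and the series at most [2 * (1 / 2) = 1]. *)
have G2 u v : 0 < v < 1 -> `|G u v| <= 2.
  move=> /andP[v0 v1]; apply: le_trans (ler_normD _ _) _.
  rewrite (_ : 2 = 1 + 1 :> R)// lerD//; first by rewrite ger0_norm ltW.
  apply: le_trans (norm_sum_dominated cvga (M := 2) _) _ => [k|].
    exact: D_le.
  by have := A_le; lra.
(* The tail is at most [1 / 2], so the truncation error adds at most 1 to the bound 2. *)
have Gn2 n u v : 0 < v < 1 -> `|Gn n u v| <= 3.
  move=> v01.
  rewrite (_ : Gn n u v = G u v - (G u v - Gn n u v)); last by rewrite subKr.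
  apply: le_trans (ler_normB _ _) _.
  have := G2 u v v01; have := GGn n u v; have := A_le.
  have : 0 <= \sum_(1 <= k < n) a k by rewrite sumr_ge0.
  rewrite /tail; lra.
apply: (cvg_double_int01 (fn := fun n u v => Gn n u v * Gn n v u)
  (e := fun n => 10 * tail n)).
- by move=> n v; exact: has_int01_dtrig_prod.
- by move=> n; exact: has_int02_dtrig_prod.
- move=> n u v u01 v01; rewrite partial1_trig// p2//.
  (* In this splitting, factors bounded by 2 and 3 multiply errors bounded by [2 * tail n], which
     produces the constant 10. *)
  have -> : G u v * G v u - Gn n u v * Gn n v u =
    G v u * (G u v - Gn n u v) + Gn n u v * (G v u - Gn n v u) by ring.
  apply: le_trans (ler_normD _ _) _; rewrite !normrM.
  rewrite (_ : 10 * _ = 2 * (2 * tail n) + 3 * (2 * tail n)); last by ring.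
  by rewrite lerD// ler_pM// ?G2 ?Gn2.
- by rewrite -[0](mulr0 10); apply: cvgMr; exact: cvg_tail0.
Qed.

Lemma cvg_mu_series : cvgn (fun n => \sum_(1 <= k < n) mu k / k%:R ^+ 2).
Proof.
apply: (cvg_dominated cvga (M := 1)) => k k0.
by rewrite mul1r (le_trans (w_div_sqr_le _ k0))// lerDr.
Qed.

Lemma norm_mu_series : `|\sum_(1 <= k <oo) (mu k / k%:R ^+ 2)| <= 1 / 2.
Proof.
apply: le_trans A_le; rewrite -[leRHS]mul1r.
apply: (norm_sum_dominated cvga) => k k0.
by rewrite mul1r (le_trans (w_div_sqr_le _ k0))// lerDr.
Qed.

(** Since [|mu k| <= 1 / 2], the product term is at most [|lambda k|], so the numerator is at most
    [4 * |mu k| + |lambda k|]. *)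
Let kendall_term_le k : (0 < k)%N ->
  `|(4 * mu k + 2 * lambda k * mu k) / k%:R ^+ 2| <= 4 * a k.
Proof.
move=> k0; apply: le_trans (w_div_sqr_le (fun k => 4 * mu k + 2 * lambda k * mu k) k0) _.
have mu1 : `|mu k| <= 1 / 2.
  (* The bound [k.+1] makes [k] the last index of the partial sum, so a single term is at most the
     total. *)
  apply: le_trans A_le; apply: le_trans (psum_le cvga k.+1 a_ge0).
  rewrite big_nat_recr//= (le_trans (_ : _ <= a k)) ?lerDl ?lerDr//.
  by rewrite sumr_ge0.
apply: le_trans (ler_normD _ _) _; rewrite !normrM !normr_nat.
have : `|lambda k| * `|mu k| <= `|lambda k| * (1 / 2) by rewrite ler_wpM2l.
by rewrite /a; have := normr_ge0 (lambda k); lra.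
Qed.

Lemma cvg_kendall_series :
  cvgn (fun n => \sum_(1 <= k < n) (4 * mu k + 2 * lambda k * mu k) / k%:R ^+ 2).
Proof. by apply: (cvg_dominated cvga (M := 4)) => k; exact: kendall_term_le. Qed.

Lemma norm_kendall_series :
  `|\sum_(1 <= k <oo) ((4 * mu k + 2 * lambda k * mu k) / k%:R ^+ 2)| <= 2.
Proof.
apply: le_trans (norm_sum_dominated cvga (M := 4) _) _ => [k|].
  exact: kendall_term_le.
by have := A_le; lra.
Qed.

(** The double integral is [1 / 4] plus [1 / (2 pi^2)] times the series; multiplying by 12 and
    subtracting 3 cancels the constant. *)
Lemma spearman_rhoE (C : R -> R -> R) :
  (forall u v, u \in `[0, 1] -> v \in `[0, 1] -> C u v = trig_copula lambda mu u v) ->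
  spearman_rho C = 6 / pi ^+ 2 * (\sum_(1 <= k <oo) (mu k / k%:R ^+ 2)).
Proof.
move=> CE; rewrite /spearman_rho.
have qE : (fun n => 1 / 4 + \sum_(1 <= k < n) q k) =
    (fun n => 1 / 4 + 1 / (2 * pi ^+ 2) * \sum_(1 <= k < n) mu k / k%:R ^+ 2).
  apply/funext => n; rewrite mulr_sumr; congr (_ + _).
  rewrite big_nat [RHS]big_nat; apply: eq_bigr => k /andP[k0 _].
  rewrite /q /scaled; move: (@pi R) (pi_gt0 R) => P P0; field.
  by rewrite !gt_eqF ?ltr0n.
have := spearman_cvg CE; rewrite qE => cI.
have cS : (1 / 4 + 1 / (2 * pi ^+ 2) * \sum_(1 <= k < n) mu k / k%:R ^+ 2) @[n --> \oo] -->
    1 / 4 + 1 / (2 * pi ^+ 2) * \sum_(1 <= k <oo) (mu k / k%:R ^+ 2).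
  by apply: cvgD; [exact: cvg_cst|apply: cvgMr; exact: cvg_mu_series].
rewrite (cvg_unique (@Rhausdorff R) cI cS).
by move: (@pi R) (pi_gt0 R) => P P0; field; rewrite gt_eqF.
Qed.

Lemma kendall_tauE (C : R -> R -> R) :
  (forall u v, u \in `[0, 1] -> v \in `[0, 1] -> C u v = trig_copula lambda mu u v) ->
  kendall_tau C = 1 / pi ^+ 2 *
    (\sum_(1 <= k <oo) ((4 * mu k + 2 * lambda k * mu k) / k%:R ^+ 2)).
Proof.
move=> CE; rewrite /kendall_tau.
pose w k : R := (4 * mu k + 2 * lambda k * mu k) / k%:R ^+ 2.
(* With [freq R k = 2 pi k], the product term is [lambda k * mu k / (2 pi^2 k^2)] and [2 * q k] is
   [mu k / (pi^2 k^2)]; together they make [w k / (4 pi^2)]. *)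
have wE : (fun n => 1 / 4 - \sum_(1 <= k < n) (2 * q k + freq R k ^+ 2 * p k * q k / 2)) =
    (fun n => 1 / 4 - 1 / (4 * pi ^+ 2) * \sum_(1 <= k < n) w k).
  apply/funext => n; rewrite mulr_sumr; congr (_ - _).
  rewrite big_nat [RHS]big_nat; apply: eq_bigr => k /andP[k0 _].
  rewrite /p /q /scaled /w /freq; move: (@pi R) (pi_gt0 R) => P P0; field.
  by rewrite !gt_eqF ?ltr0n.
have := kendall_cvg CE; rewrite wE => cI.
have cS : (1 / 4 - 1 / (4 * pi ^+ 2) * \sum_(1 <= k < n) w k) @[n --> \oo] -->
    1 / 4 - 1 / (4 * pi ^+ 2) * \sum_(1 <= k <oo) w k.
  by apply: cvgB; [exact: cvg_cst|apply: cvgMr; exact: cvg_kendall_series].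
rewrite (cvg_unique (@Rhausdorff R) cI cS).
by move: (@pi R) (pi_gt0 R) => P P0; field; rewrite gt_eqF.
Qed.

End TrigCopulaSeries.

Theorem lemma2 (R : realType) (lambda mu : nat -> R) (C : R -> R -> R)
  (Hsum : (\sum_(1 <= k <oo) (`|lambda k| + `|mu k|)%:E <= (1 / 2)%:E)%E)
  (HC : is_copula C)
  (HCE : forall u v : R, u \in `[0, 1] -> v \in `[0, 1] ->
     C u v = trig_copula lambda mu u v) :
  [/\ spearman_rho C = 6 / pi ^+ 2 * (\sum_(1 <= k <oo) (mu k / k%:R ^+ 2)),
      - (3 / pi ^+ 2) <= spearman_rho C <= 3 / pi ^+ 2,
      kendall_tau C = 1 / pi ^+ 2 *
        (\sum_(1 <= k <oo) ((4 * mu k + 2 * lambda k * mu k) / k%:R ^+ 2)) &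
      - (2 / pi ^+ 2) <= kendall_tau C <= 2 / pi ^+ 2].
Proof.
have pi2 : 0 <= (pi ^+ 2 : R)^-1 by rewrite invr_ge0 sqr_ge0.
have rhoE := spearman_rhoE Hsum HCE; have tauE := kendall_tauE Hsum HCE.
split=> //; rewrite -ler_norml.
- rewrite rhoE normrM ger0_norm ?mulr_ge0//.
  (* The factor [1 / 2] is the bound on the series of [mu k / k^2]. *)
  have -> : 3 / pi ^+ 2 = 6 / pi ^+ 2 * (1 / 2) :> R.
    by rewrite mulrAC; congr (_ / _); field.
  by apply: ler_wpM2l; [exact: mulr_ge0|exact: (norm_mu_series Hsum)].
- rewrite tauE normrM ger0_norm ?mulr_ge0// mul1r mulrC ler_wpM2r//.
  exact: (norm_kendall_series Hsum).
Qed.
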